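(* Let $K$ be a compact abelian group with discrete dual group $\Gamma=\widehat K$ (written additively), and let $\alpha:K\to\mathrm{Aut}(A)$ be an action by $*$-automorphisms on a $*$-algebra $A$. For $\gamma\in\Gamma$ let $A_\gamma^\alpha:=\{a\in A:\alpha_t(a)=\gamma(t)a\ \forall t\in K\}$, and let $A_{\mathrm{fin}}^\alpha:=\bigoplus^{\mathrm{alg}}_{\gamma\in\Gamma}A_\gamma^\alpha$ denote the finite spectral core. (i) The decomposition $A_{\mathrm{fin}}^\alpha=\bigoplus^{\mathrm{alg}}_\gamma A_\gamma^\alpha$ is a $\Gamma$-grading: $A_\gamma^\alpha A_\eta^\alpha\subseteq A_{\gamma+\eta}^\alpha$ and $(A_\gamma^\alpha)^*\subseteq A_{-\gamma}^\alpha$. (ii) Given a normalized unitary $2$-cocycle $\sigma$ on $\Gamma$, define a bilinear product on $A_{\mathrm{fin}}^\alpha$ by $a_\gamma\star_\sigma b_\eta:=\sigma(\gamma,\eta)\,a_\gamma b_\eta$ for $a_\gamma\in A_\gamma^\alpha$, $b_\eta\in A_\eta^\alpha$, extended by bilinearity to finite sums. Then $\star_\sigma$ is associative on $A_{\mathrm{fin}}^\alpha$. Moreover, with the original involution on $A$, the identity $(a\star_\sigma b)^*=b^*\star_\sigma a^*$ for all $a,b\in A_{\mathrm{fin}}^\alpha$ holds if and only if $\overline{\sigma(\gamma,\eta)}=\sigma(-\eta,-\gamma)$ for all $\gamma,\eta\in\Gamma$. (iii) The product $\star_\sigma$ depends only on the graded pieces $(A_\gamma^\alpha)_\gamma$ and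 $\sigma$: if $\beta:K\to\mathrm{Aut}(A)$ is another action with $A_\gamma^\beta=A_\gamma^\alpha$ for all $\gamma\in\Gamma$, then the corresponding cocycle-twisted products coincide on the common graded core.
   Context: $\mathbb{T}=\{z\in\mathbb{C}:|z|=1\}$. A normalized unitary $2$-cocycle on $\Gamma$ is a map $\sigma:\Gamma\times\Gamma\to\mathbb{T}$ with $\sigma(p,0)=\sigma(0,p)=1$ and $\sigma(p,q)\sigma(p+q,r)=\sigma(q,r)\sigma(p,q+r)$ for all $p,q,r\in\Gamma$. A $\Gamma$-graded $*$-algebra is a $*$-algebra $A$ with a vector space decomposition $A=\bigoplus^{\mathrm{alg}}_\gamma A_\gamma$ such that $A_\gamma A_\eta\subseteq A_{\gamma+\eta}$ and $A_\gamma^*\subseteq A_{-\gamma}$. $*$-algebras are over $\mathbb{C}$.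
   Formalization: In (ii) ''only if'' fails for one fixed action (e.g. A=ℂ, trivial action of ℤ/2, σ(1,1)=i); proved instead: the identity holds iff the condition on σ holds at all γ,η with A_γA_η≠0; so at all γ,η if no A_γA_η vanishes, or if the identity is required for all *-algebras and actions of K. *)

(* Defs.v *)
From HB Require Import structures.
From mathcomp Require Import all_boot all_order all_algebra.
From mathcomp Require Import all_classical all_reals all_analysis.
From mathcomp.real_closed Require Import complex.

Set Implicit Arguments.
Unset Strict Implicit.
Unset Printing Implicit Defensive.

Import Order.TTheory GRing.Theory Num.Theory.
Import numFieldNormedType.Exports.

Local Open Scope classical_set_scope.
Local Open Scope complex_scope.
Local Open Scope ring_scope.

(* R[i] seen as a numFieldType, which gives it the topology of its norm. *)
Local Notation topC R := (Num.NumField.sort (R[i] : numFieldType)).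

(* The group K is written additively, so a continuous character is a
   continuous map with chi (s + t) = chi s * chi t and values of modulus 1. *)
Record dual (R : realType) (K : topologicalZmodType) := Character {
  char_fun :> K -> R[i];
  char_continuous : continuous (char_fun : K -> topC R);
  char_norm : forall t, `|char_fun t| = 1;
  charD : forall s t, char_fun (s + t) = char_fun s * char_fun t }.

Section DualGroup.
Context {R : realType} {K : topologicalZmodType}.
Implicit Types (chi psi : dual R K).

Lemma dual_ext chi psi : (forall t, chi t = psi t) -> chi = psi.
Proof.
case: chi => f fc fn fD; case: psi => g gc gn gD /= /funext fg.
by subst g; congr Character; exact: Prop_irrelevance.
Qed.

Fact char0_continuous : continuous (fun _ : K => 1 : topC R).
Proof. by move=> t; exact: cvg_cst. Qed.

Fact char0_norm (t : K) : `|(fun _ : K => 1 : R[i]) t| = 1.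
Proof. exact: normr1. Qed.

Fact char0_morph (s t : K) :
  (fun _ : K => 1 : R[i]) (s + t) = (fun _ => 1) s * (fun _ => 1) t.
Proof. by rewrite mulr1. Qed.

Definition dual_zero : dual R K :=
  Character char0_continuous char0_norm char0_morph.

Fact charM_continuous chi psi : continuous (fun t => chi t * psi t : topC R).
Proof. by move=> t; exact: (cvgM (@char_continuous _ _ chi t) (@char_continuous _ _ psi t)). Qed.

Fact charM_norm chi psi t : `|chi t * psi t| = 1.
Proof. by rewrite normrM !char_norm mulr1. Qed.

Fact charM_morph chi psi s t :
  chi (s + t) * psi (s + t) = (chi s * psi s) * (chi t * psi t).
Proof. by rewrite !charD mulrACA. Qed.

Definition dual_add chi psi : dual R K :=
  Character (@charM_continuous chi psi) (charM_norm chi psi)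
            (charM_morph chi psi).

Lemma char_neq0 chi t : chi t != 0.
Proof. by rewrite -normr_gt0 char_norm. Qed.

Fact charV_continuous chi : continuous (fun t => (chi t)^-1 : topC R).
Proof.
by move=> t; exact: (cvgV (char_neq0 chi t) (@char_continuous _ _ chi t)).
Qed.

Fact charV_norm chi t : `|(chi t)^-1| = 1.
Proof. by rewrite normfV char_norm invr1. Qed.

Fact charV_morph chi s t : (chi (s + t))^-1 = (chi s)^-1 * (chi t)^-1.
Proof. by rewrite charD invfM. Qed.

Definition dual_opp chi : dual R K :=
  Character (@charV_continuous chi) (charV_norm chi) (charV_morph chi).

HB.instance Definition _ := gen_eqMixin (dual R K).
HB.instance Definition _ := gen_choiceMixin (dual R K).

Fact dual_addA : associative dual_add.
Proof. by move=> x y z; apply: dual_ext => t; exact: mulrA. Qed.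

Fact dual_addC : commutative dual_add.
Proof. by move=> x y; apply: dual_ext => t; exact: mulrC. Qed.

Fact dual_add0 : left_id dual_zero dual_add.
Proof. by move=> x; apply: dual_ext => t; exact: mul1r. Qed.

Fact dual_addN : left_inverse dual_zero dual_opp dual_add.
Proof. by move=> x; apply: dual_ext => t; exact: (mulVf (char_neq0 x t)). Qed.

HB.instance Definition _ := GRing.isZmodule.Build (dual R K)
  dual_addA dual_addC dual_add0 dual_addN.

End DualGroup.

(* A *-algebra is not required to have a unit; the ring structures of the
   library all are unital, whence this structure on top of Lmodule. *)
HB.mixin Record Lmodule_isStarAlgebra (R : realType) A
    of GRing.Lmodule R[i] A := {
  smul : A -> A -> A;
  adj : A -> A;
  smulA : forall a b c : A, smul a (smul b c) = smul (smul a b) c;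
  smul_linearl : forall (k : R[i]) (a b c : A),
    smul (k *: a + b) c = k *: smul a c + smul b c;
  smul_linearr : forall (k : R[i]) (a b c : A),
    smul a (k *: b + c) = k *: smul a b + smul a c;
  adj_conjlinear : forall (k : R[i]) (a b : A),
    adj (k *: a + b) = k^* *: adj a + adj b;
  adjM : forall a b : A, adj (smul a b) = smul (adj b) (adj a);
  adjK : forall a : A, adj (adj a) = a }.

#[short(type="starAlgType")]
HB.structure Definition StarAlgebra (R : realType) :=
  { A of GRing.Lmodule R[i] A & Lmodule_isStarAlgebra R A }.

(* Bijectivity of each act t follows from act0 and actD, so that this is a
   group homomorphism from K to the *-automorphisms of A. *)
Record star_action (R : realType) (K : topologicalZmodType)
    (A : starAlgType R) := StarAction {
  act :> K -> A -> A;
  act_linear : forall t (k : R[i]) (a b : A),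
    act t (k *: a + b) = k *: act t a + act t b;
  act_smul : forall t (a b : A), act t (smul a b) = smul (act t a) (act t b);
  act_adj : forall t (a : A), act t (adj a) = adj (act t a);
  act0 : forall a : A, act 0 a = a;
  actD : forall s t (a : A), act (s + t) a = act s (act t a) }.

Section Grading.
Context {R : realType} {G : zmodType} {A : starAlgType R}.
Implicit Types (V : G -> set A) (B : set A).

Definition linear_subspace B : Prop :=
  B 0 /\ forall (k : R[i]) (a b : A), B a -> B b -> B (k *: a + b).

Definition star_subalgebra B : Prop :=
  [/\ linear_subspace B,
      forall a b, B a -> B b -> B (smul a b) &
      forall a, B a -> B (adj a)].

Definition decomposition V (a : A) (f : G -> A) : Prop :=
  [/\ finite_set [set g | f g != 0],
      forall g, V g (f g) &
      a = \sum_(g \in [set: G]) f g].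

Definition alg_direct_sum V B : Prop :=
  [/\ forall g, linear_subspace (V g),
      forall a, B a <-> exists f, decomposition V a f &
      forall a f f', decomposition V a f -> decomposition V a f' -> f = f'].

Definition star_grading V B : Prop :=
  [/\ star_subalgebra B,
      alg_direct_sum V B,
      forall g h a b, V g a -> V h b -> V (g + h) (smul a b) &
      forall g a, V g a -> V (- g) (adj a)].

(* The homogeneous components of a; they are meaningful when V is independent
   and a is a finite sum of elements of the V g. *)
Definition components V (a : A) : G -> A :=
  xget (fun=> 0) [set f | decomposition V a f].

End Grading.

Section SpectralCore.
Context {R : realType} {K : topologicalZmodType} {A : starAlgType R}.
Implicit Types (alpha : star_action K A) (sigma : dual R K -> dual R K -> R[i]).

Definition spectral alpha (g : dual R K) : set A :=
  [set a | forall t, alpha t a = g t *: a].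

Definition fin_core alpha : set A :=
  [set a | exists f, decomposition (spectral alpha) a f].

(* Both sums have finite support when a and b are in the core, which is where
   this product is considered. *)
Definition twist alpha sigma (a b : A) : A :=
  \sum_(g \in [set: dual R K]) \sum_(h \in [set: dual R K])
    sigma g h *: smul (components (spectral alpha) a g)
                      (components (spectral alpha) b h).

Definition twisted_product alpha sigma (m : A -> A -> A) : Prop :=
  let B := fin_core alpha in
  [/\ forall a b, B a -> B b -> B (m a b),
      forall (k : R[i]) a b c, B a -> B b -> B c ->
        m (k *: a + b) c = k *: m a c + m b c,
      forall (k : R[i]) a b c, B a -> B b -> B c ->
        m a (k *: b + c) = k *: m a b + m a c &
      forall g h a b, spectral alpha g a -> spectral alpha h b ->
        m a b = sigma g h *: smul a b].

Definition twist_adjM alpha sigma : Prop :=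
  forall a b, fin_core alpha a -> fin_core alpha b ->
    adj (twist alpha sigma a b) = twist alpha sigma (adj b) (adj a).

End SpectralCore.

Definition normalized_unitary_cocycle (R : realType) (G : zmodType)
    (sigma : G -> G -> R[i]) : Prop :=
  [/\ forall p q, `|sigma p q| = 1,
      forall p, sigma p 0 = 1,
      forall p, sigma 0 p = 1 &
      forall p q r, sigma p q * sigma (p + q) r = sigma q r * sigma p (q + r)].

(* Main.v *)
(* Spectral subspaces of distinct characters are independent, by the argument
   for eigenspaces, so an element of the core has well-defined homogeneous
   components and the twisted product is bilinear on the core. Each identity
   about it thus reduces to homogeneous elements, where associativity is the
   cocycle identity, and where (a * b)^* and b^* * a^* are the multiples of
   (a b)^* by the conjugate of sigma g h and by sigma (- h) (- g). *)

Require Import Defs.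
From HB Require Import structures.
From mathcomp Require Import all_boot all_order all_algebra.
From mathcomp Require Import all_classical all_reals all_analysis.
From mathcomp.real_closed Require Import complex.

Import Order.TTheory GRing.Theory Num.Theory.
Import numFieldNormedType.Exports.

Local Open Scope classical_set_scope.
Local Open Scope complex_scope.
Local Open Scope ring_scope.

Set Implicit Arguments.
Unset Strict Implicit.
Unset Printing Implicit Defensive.

(** * Sums of finitely supported families *)

Section FinitelySupportedSums.
Context {G : choiceType} {V : zmodType}.
Implicit Types (f : G -> V) (s : seq G).

(** The list may exceed the support, so that one list can serve several families at once. *)
Definition covers s f := forall g, g \notin s -> f g = 0.

(** A list enumerating the union of the two supports allows two finite sums to be combined term by
    term. *)
Lemma covers_seq f f' :
  finite_set [set g | f g != 0] -> finite_set [set g | f' g != 0] ->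
  exists s, [/\ uniq s, covers s f & covers s f'].
Proof.
move=> ff ff'; have /finite_seqP[s sE] : finite_set
    ([set g | f g != 0] `|` [set g | f' g != 0]) by rewrite finite_setU.
have sP g : g \notin s -> f g = 0 /\ f' g = 0.
  move=> gs; have : ~ ([set g | f g != 0] `|` [set g | f' g != 0]) g.
    by rewrite sE /=; apply/negP.
  by move=> /not_orP[/= /negP/negPn/eqP-> /negP/negPn/eqP->].
exists (undup s); split=> [|g|g]; rewrite ?undup_uniq// mem_undup => /sP[] //.
Qed.

Lemma covers_finite s f : covers s f -> finite_set [set g | f g != 0].
Proof.
move=> sf; apply: (@sub_finite_set _ _ [set` s]); last exact: finite_seq.
by move=> g /=; apply: contra_neqT => /sf.
Qed.

Lemma fsum_covers s f : uniq s -> covers s f ->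
  \sum_(g \in [set: G]) f g = \sum_(g <- s) f g.
Proof.
move=> us sf; rewrite (@fsbigE _ _ _ _ _ s)// => [|g _]; last exact: sf.
by apply: eq_bigl => g; rewrite in_setT.
Qed.

End FinitelySupportedSums.

(** * Linearity of the product and conjugate-linearity of the involution *)

Section StarAlgebraTheory.
Context {R : realType} {A : starAlgType R}.
Implicit Types (k : R[i]) (a b c : A).

Lemma smulDl a b c : smul (a + b) c = smul a c + smul b c.
Proof. by have := smul_linearl 1 a b c; rewrite !scale1r. Qed.

Lemma smulDr a b c : smul a (b + c) = smul a b + smul a c.
Proof. by have := smul_linearr 1 a b c; rewrite !scale1r. Qed.

Lemma smul0l c : smul 0 c = 0.
Proof. by apply: (addrI (smul 0 c)); rewrite -smulDl !addr0. Qed.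

Lemma smul0r a : smul a 0 = 0.
Proof. by apply: (addrI (smul a 0)); rewrite -smulDr !addr0. Qed.

Lemma smulZl k a c : smul (k *: a) c = k *: smul a c.
Proof. by have := smul_linearl k a 0 c; rewrite smul0l !addr0. Qed.

Lemma smulZr k a c : smul a (k *: c) = k *: smul a c.
Proof. by have := smul_linearr k a c 0; rewrite smul0r !addr0. Qed.

Lemma adjD a b : adj (a + b) = adj a + adj b.
Proof. by have := adj_conjlinear 1 a b; rewrite rmorph1 !scale1r. Qed.

Lemma adj0 : adj (0 : A) = 0.
Proof. by apply: (addrI (adj 0)); rewrite -adjD !addr0. Qed.

Lemma adjZ k a : adj (k *: a) = k^* *: adj a.
Proof. by have := adj_conjlinear k a 0; rewrite adj0 !addr0. Qed.

Lemma subspaceD (B : set A) a b :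
  linear_subspace B -> B a -> B b -> B (a + b).
Proof. by case=> _ BL Ba Bb; rewrite -[a]scale1r; exact: BL. Qed.

Lemma subspaceZ (B : set A) k a : linear_subspace B -> B a -> B (k *: a).
Proof. by case=> B0 BL Ba; rewrite -[X in B X]addr0; exact: BL. Qed.

End StarAlgebraTheory.

(** * Decompositions along a family of subspaces *)

Section Decompositions.
Context {R : realType} {G : zmodType} {A : starAlgType R}.
Context {V : G -> set A} (Vsub : forall g, linear_subspace (V g)).
Implicit Types (a b : A) (f : G -> A).

Lemma decomposition_linear (k : R[i]) a b f f' :
  decomposition V a f -> decomposition V b f' ->
  decomposition V (k *: a + b) (fun g => k *: f g + f' g).
Proof.
move=> [ff fV ->] [ff' fV' ->]; have [s [us sf sf']] := covers_seq ff ff'.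
have sk : covers s (fun g => k *: f g + f' g).
  by move=> g gs; rewrite sf// sf'// scaler0 addr0.
split; first exact: covers_finite sk.
- by move=> g; have [_] := Vsub g; apply.
- by rewrite !(fsum_covers (s := s))// big_split scaler_sumr.
Qed.

Lemma decomposition_homogeneous g a : V g a ->
  decomposition V a (fun h => if h == g then a else 0).
Proof.
move=> Va; have sg : covers [:: g] (fun h => if h == g then a else 0).
  by move=> h; rewrite inE => /negbTE->.
split; first exact: covers_finite sg.
- by move=> h; case: eqP => [->//|_]; have [] := Vsub h.
- by rewrite (fsum_covers (s := [:: g]))// big_seq1 eqxx.
Qed.

Lemma span_subspace : linear_subspace [set a | exists f, decomposition V a f].
Proof.
split=> [|k a b [f fa] [f' fb]].
  (* This form of the zero family is the one that [decomposition_homogeneous] yields for the vector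
     0 in degree 0. *)
  by exists (fun h => if h == 0 then 0 else 0);
    apply: decomposition_homogeneous; have [] := Vsub 0.
by exists (fun g => k *: f g + f' g); exact: decomposition_linear.
Qed.

(** Reduces additive properties to homogeneous elements. The step for a sum also receives membership
    of both summands in the span, because additivity of the twisted product is established only
    there. *)
Lemma span_ind (P : A -> Prop) :
  (forall g a, V g a -> P a) ->
  (forall a b, (exists f, decomposition V a f) ->
     (exists f, decomposition V b f) -> P a -> P b -> P (a + b)) ->
  forall a, (exists f, decomposition V a f) -> P a.
Proof.
move=> PV PD a [f [ff fV ->]]; have [s [us sf _]] := covers_seq ff ff.
rewrite (fsum_covers (s := s))//.
(* Membership of the partial sums is carried through the induction, since [PD] asks for it. *)
suff [] : (exists f', decomposition V (\sum_(g <- s) f g) f') /\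
          P (\sum_(g <- s) f g) by [].
elim: s {us sf} => [|g s [IHs IHP]].
  rewrite big_nil; have [V0 _] := Vsub 0; split; last exact: PV V0.
  by have [] := span_subspace.
have gf : exists f', decomposition V (f g) f'.
  by eexists; exact: decomposition_homogeneous (fV g).
rewrite big_cons; split; last by apply: PD => //; exact: PV (fV g).
exact: (subspaceD span_subspace gf IHs).
Qed.

(** [xget] selects an unspecified decomposition; uniqueness forces it to be the given one. *)
Lemma componentsE :
  (forall a f f', decomposition V a f -> decomposition V a f' -> f = f') ->
  forall a f, decomposition V a f -> components V a = f.
Proof.
move=> Vuniq a f fa; apply: xget_unique => // f' fa'; exact: Vuniq fa' fa.
Qed.

End Decompositions.

(** * Spectral subspaces and the grading of the core *)

Section Spectral.
Context {R : realType} {K : topologicalZmodType} {A : starAlgType R}.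
Context (alpha : star_action K A).
Implicit Types (g h : dual R K) (a b : A).

Lemma act_add t a b : alpha t (a + b) = alpha t a + alpha t b.
Proof. by have := act_linear alpha t 1 a b; rewrite !scale1r. Qed.

Lemma act_zero t : alpha t 0 = 0.
Proof. by apply: (addrI (alpha t 0)); rewrite -act_add !addr0. Qed.

Lemma spectral_subspace g : linear_subspace (spectral alpha g).
Proof.
split=> [t|k a b ag bg t]; first by rewrite act_zero scaler0.
by rewrite act_linear ag bg scalerDr !scalerA mulrC.
Qed.

Lemma spectralM g h a b : spectral alpha g a -> spectral alpha h b ->
  spectral alpha (g + h) (smul a b).
Proof. by move=> ag bh t; rewrite act_smul ag bh smulZl smulZr scalerA. Qed.

(** A number of modulus 1 has its inverse as conjugate, and negation in the dual group is pointwise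
    inversion. *)
Lemma conj_char g t : (g t)^* = (- g) t.
Proof. by rewrite [RHS]invC_norm char_norm expr1n invr1 mul1r. Qed.

Lemma spectral_adj g a : spectral alpha g a -> spectral alpha (- g) (adj a).
Proof. by move=> ag t; rewrite act_adj ag adjZ conj_char. Qed.

(* Applying [alpha t - g0 t] removes the term of degree [g0] and rescales the
   term of degree [h] by [h t - g0 t], which is nonzero for a suitable [t]. *)
Lemma spectral_free (s : seq (dual R K)) (f : dual R K -> A) : uniq s ->
  (forall g, spectral alpha g (f g)) ->
  \sum_(g <- s) f g = 0 -> forall g, g \in s -> f g = 0.
Proof.
elim: s f => [//|g0 s IHs] f /= /andP[g0s us] fV; rewrite big_cons => sum0.
have fs0 h : h \in s -> f h = 0.
  (* Otherwise [h] and [g0] agree everywhere, hence are equal, although [g0] is not in [s]. *)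
  move=> hs; have [t ht] : exists t, h t != g0 t.
    apply: contra_notP (negP g0s) => /forallNP hg0.
    suff <- : h = g0 by [].
    by apply: dual_ext => t; apply/eqP/negPn/negP; exact: hg0.
  have : (h t - g0 t) *: f h = 0.
    apply: (IHs (fun g => (g t - g0 t) *: f g)) => // [g|].
      by apply: subspaceZ (fV g); exact: spectral_subspace.
    under eq_bigr do rewrite scalerBl.
    rewrite sumrB -scaler_sumr.
    have -> : \sum_(g <- s) f g = - f g0.
      by apply/eqP; rewrite -addr_eq0 addrC sum0.
    rewrite scalerN opprK addrC; have := act_zero t; rewrite -{1}sum0 act_add fV.
    rewrite (big_morph _ (act_add t) (act_zero t)) => {2}<-; congr (_ + _).
    by apply: eq_bigr => g _; rewrite fV.
  by move=> /eqP; rewrite scaler_eq0 subr_eq0 (negbTE ht) => /eqP.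
move=> h; rewrite inE => /predU1P[->|/fs0//].
by rewrite -[LHS]addr0 -[RHS]sum0; congr (_ + _); rewrite big_seq big1.
Qed.

(** The difference of two decompositions is a vanishing sum of spectral elements, so [spectral_free]
    kills it on a common list; off that list both families are zero. *)
Lemma spectral_uniq a f f' : decomposition (spectral alpha) a f ->
  decomposition (spectral alpha) a f' -> f = f'.
Proof.
move=> [ff fV fa] [ff' fV' fa']; have [s [us sf sf']] := covers_seq ff ff'.
have d0 : forall g, g \in s -> f g - f' g = 0.
  apply: (@spectral_free s (fun g => f g - f' g)) => // [g|].
    rewrite addrC -scaleN1r; have [_] := spectral_subspace g; exact.
  by rewrite sumrB -!fsum_covers// -fa -fa' subrr.
apply/funext => g; have [/d0/eqP|gs] := boolP (g \in s).
  by rewrite subr_eq0 => /eqP.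
by rewrite sf// sf'.
Qed.

Lemma fin_core_ind (P : A -> Prop) :
  (forall g a, spectral alpha g a -> P a) ->
  (forall a b, fin_core alpha a -> fin_core alpha b ->
     P a -> P b -> P (a + b)) ->
  forall a, fin_core alpha a -> P a.
Proof. exact: span_ind spectral_subspace P. Qed.

Lemma fin_core_subspace : linear_subspace (fin_core alpha).
Proof. exact: span_subspace spectral_subspace. Qed.

Lemma spectral_fin_core g a : spectral alpha g a -> fin_core alpha a.
Proof.
by move=> ag; exists (fun h => if h == g then a else 0);
  apply: decomposition_homogeneous ag; exact: spectral_subspace.
Qed.

Lemma fin_core_smul a b :
  fin_core alpha a -> fin_core alpha b -> fin_core alpha (smul a b).
Proof.
move=> ca cb; elim/fin_core_ind: a / ca => [g a ag|a a' _ _ ca ca']; last first.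
  by rewrite smulDl; exact: subspaceD fin_core_subspace ca ca'.
elim/fin_core_ind: b / cb => [h b bh|b b' _ _ cb cb'].
  exact: spectral_fin_core (spectralM ag bh).
by rewrite smulDr; exact: subspaceD fin_core_subspace cb cb'.
Qed.

Lemma fin_core_adj a : fin_core alpha a -> fin_core alpha (adj a).
Proof.
elim/fin_core_ind: a / => [g a ag|a a' _ _ ca ca'].
  exact: spectral_fin_core (spectral_adj ag).
by rewrite adjD; exact: subspaceD fin_core_subspace ca ca'.
Qed.

Lemma spectral_grading : star_grading (spectral alpha) (fin_core alpha).
Proof.
split; [split|split| |].
- exact: fin_core_subspace.
- exact: fin_core_smul.
- exact: fin_core_adj.
- exact: spectral_subspace.
- by [].
- exact: spectral_uniq.
- exact: spectralM.
- exact: spectral_adj.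
Qed.

(** * The cocycle-twisted product *)

Section Twist.
Context (sigma : dual R K -> dual R K -> R[i]).

(** Makes the product computable from any explicit decompositions: an index outside its list gives a
    zero factor, so both sums become sums over lists. *)
Lemma twist_covers s s' a b f f' : uniq s -> uniq s' ->
  decomposition (spectral alpha) a f -> decomposition (spectral alpha) b f' ->
  covers s f -> covers s' f' ->
  twist alpha sigma a b =
  \sum_(g <- s) \sum_(h <- s') sigma g h *: smul (f g) (f' h).
Proof.
move=> us us' fa fb sf sf'.
rewrite /twist (componentsE spectral_uniq fa) (componentsE spectral_uniq fb).
have inner g : \sum_(h \in [set: dual R K]) sigma g h *: smul (f g) (f' h) =
               \sum_(h <- s') sigma g h *: smul (f g) (f' h).
  by apply: fsum_covers => // h hs'; rewrite sf'// smul0r scaler0.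
under eq_fsbigr do rewrite inner.
apply: fsum_covers => // g gs.
by rewrite big1// => h _; rewrite sf// smul0l scaler0.
Qed.

Lemma twist_linearl k a b c :
  fin_core alpha a -> fin_core alpha b -> fin_core alpha c ->
  twist alpha sigma (k *: a + b) c =
  k *: twist alpha sigma a c + twist alpha sigma b c.
Proof.
move=> [f fa] [f' fb] [f'' fc].
have [[ff _ _] [ff' _ _] [ff'' _ _]] := And3 fa fb fc.
have [s [us sf sf']] := covers_seq ff ff'.
have [s'' [us'' sf'' _]] := covers_seq ff'' ff''.
have sk : covers s (fun g => k *: f g + f' g).
  by move=> g gs; rewrite sf// sf'// scaler0 addr0.
have fk := decomposition_linear spectral_subspace k fa fb.
rewrite (twist_covers us us'' fk fc sk sf'').
rewrite (twist_covers us us'' fa fc sf sf'').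
rewrite (twist_covers us us'' fb fc sf' sf'').
rewrite scaler_sumr -big_split; apply: eq_bigr => g _ /=.
rewrite scaler_sumr -big_split; apply: eq_bigr => h _ /=.
by rewrite smul_linearl scalerDr !scalerA mulrC.
Qed.

Lemma twist_linearr k a b c :
  fin_core alpha a -> fin_core alpha b -> fin_core alpha c ->
  twist alpha sigma a (k *: b + c) =
  k *: twist alpha sigma a b + twist alpha sigma a c.
Proof.
move=> [f fa] [f' fb] [f'' fc].
have [[ff _ _] [ff' _ _] [ff'' _ _]] := And3 fa fb fc.
have [s [us sf _]] := covers_seq ff ff.
have [s' [us' sf' sf'']] := covers_seq ff' ff''.
have sk : covers s' (fun g => k *: f' g + f'' g).
  by move=> g gs; rewrite sf'// sf''// scaler0 addr0.
have fk := decomposition_linear spectral_subspace k fb fc.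
rewrite (twist_covers us us' fa fk sf sk).
rewrite (twist_covers us us' fa fb sf sf').
rewrite (twist_covers us us' fa fc sf sf'').
rewrite scaler_sumr -big_split; apply: eq_bigr => g _ /=.
rewrite scaler_sumr -big_split; apply: eq_bigr => h _ /=.
by rewrite smul_linearr scalerDr !scalerA mulrC.
Qed.

Lemma twistDl a b c :
  fin_core alpha a -> fin_core alpha b -> fin_core alpha c ->
  twist alpha sigma (a + b) c = twist alpha sigma a c + twist alpha sigma b c.
Proof.
by move=> ca cb cc; have := twist_linearl 1 ca cb cc; rewrite !scale1r.
Qed.

Lemma twistDr a b c :
  fin_core alpha a -> fin_core alpha b -> fin_core alpha c ->
  twist alpha sigma a (b + c) = twist alpha sigma a b + twist alpha sigma a c.
Proof.
by move=> ca cb cc; have := twist_linearr 1 ca cb cc; rewrite !scale1r.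
Qed.

Lemma twist_homogeneous g h a b :
  spectral alpha g a -> spectral alpha h b ->
  twist alpha sigma a b = sigma g h *: smul a b.
Proof.
move=> ag bh.
rewrite (@twist_covers [:: g] [:: h] _ _ _ _ isT isT
  (decomposition_homogeneous spectral_subspace ag)
  (decomposition_homogeneous spectral_subspace bh)).
- by rewrite !big_seq1 !eqxx.
- by move=> x; rewrite inE => /negbTE->.
- by move=> x; rewrite inE => /negbTE->.
Qed.

Lemma twist_fin_core a b :
  fin_core alpha a -> fin_core alpha b -> fin_core alpha (twist alpha sigma a b).
Proof.
move=> ca cb; elim/fin_core_ind: a / ca => [g a ag|a a' ca ca' ? ?]; last first.
  by rewrite twistDl//; exact: subspaceD fin_core_subspace _ _.
have ca := spectral_fin_core ag.
elim/fin_core_ind: b / cb => [h b bh|b b' cb cb' ? ?].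
  rewrite (twist_homogeneous ag bh); apply: subspaceZ fin_core_subspace _.
  exact: spectral_fin_core (spectralM ag bh).
by rewrite twistDr//; exact: subspaceD fin_core_subspace _ _.
Qed.

Lemma twist_twisted_product : twisted_product alpha sigma (twist alpha sigma).
Proof.
split; [exact: twist_fin_core | exact: twist_linearl | exact: twist_linearr |].
exact: twist_homogeneous.
Qed.

(** Bilinearity on the core reduces the comparison to homogeneous arguments, one variable at a time,
    where both products are prescribed. *)
Lemma twisted_product_uniq m : twisted_product alpha sigma m ->
  forall a b, fin_core alpha a -> fin_core alpha b ->
  m a b = twist alpha sigma a b.
Proof.
move=> [_ mDl mDr mh] a b ca cb.
elim/fin_core_ind: a / ca => [g a ag|a a' ca ca' IH IH']; last first.
  by have := mDl 1 a a' b ca ca' cb; rewrite !scale1r IH IH' twistDl.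
have ca := spectral_fin_core ag.
elim/fin_core_ind: b / cb => [h b bh|b b' cb cb' IH IH'].
  by rewrite (twist_homogeneous ag bh) (mh _ _ _ _ ag bh).
by have := mDr 1 a b b' ca cb cb'; rewrite !scale1r IH IH' twistDr.
Qed.

Lemma twistA a b c :
  (forall p q r, sigma p q * sigma (p + q) r = sigma q r * sigma p (q + r)) ->
  fin_core alpha a -> fin_core alpha b -> fin_core alpha c ->
  twist alpha sigma a (twist alpha sigma b c) =
  twist alpha sigma (twist alpha sigma a b) c.
Proof.
(* The additivity lemmas apply only on the core, so the inner products must be known to stay
   there. *)
move=> sigmaA ca cb cc; have tw := twist_fin_core.
elim/fin_core_ind: a / ca => [g a ag|a a' ca ca' IH IH']; last first.
  by rewrite !twistDl ?IH ?IH'//; exact: tw.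
have ca := spectral_fin_core ag.
elim/fin_core_ind: b / cb => [h b bh|b b' cb cb' IH IH']; last first.
  rewrite twistDl// !twistDr//; [|exact: tw..].
  by rewrite twistDl ?IH ?IH'//; exact: tw.
have cb := spectral_fin_core bh.
elim/fin_core_ind: c / cc => [l c cl|c c' cc cc' IH IH']; last first.
  rewrite !twistDr//; [|exact: tw..].
  by rewrite IH IH'.
rewrite (twist_homogeneous ag bh) (twist_homogeneous bh cl).
(* The inner products have degrees [h + l] and [g + h], so the outer ones contribute
   [sigma g (h + l)] and [sigma (g + h) l], completing the two sides of the cocycle identity. *)
have bcP : spectral alpha (h + l) (sigma h l *: smul b c).
  exact: subspaceZ (spectral_subspace _) (spectralM bh cl).
have abP : spectral alpha (g + h) (sigma g h *: smul a b).
  exact: subspaceZ (spectral_subspace _) (spectralM ag bh).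
rewrite (twist_homogeneous ag bcP) (twist_homogeneous abP cl).
by rewrite smulZl smulZr !scalerA smulA [in RHS]mulrC sigmaA mulrC.
Qed.

(** On homogeneous elements both sides are multiples of [adj (smul a b)]. This vector is nonzero
    when [smul a b] is, since [adj] is an involution, and then the scalars must agree; a zero
    product imposes no condition. *)
Lemma twist_adjMP : twist_adjM alpha sigma <->
  (forall g h,
     (exists a b, [/\ spectral alpha g a, spectral alpha h b & smul a b != 0]) ->
     (sigma g h)^* = sigma (- h) (- g)).
Proof.
have adjM_homogeneous g h a b : spectral alpha g a -> spectral alpha h b ->
    (adj (twist alpha sigma a b) = (sigma g h)^* *: adj (smul a b)) *
    (twist alpha sigma (adj b) (adj a) = sigma (- h) (- g) *: adj (smul a b)).
  move=> ag bh; rewrite (twist_homogeneous ag bh) adjZ adjM.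
  by rewrite (twist_homogeneous (spectral_adj bh) (spectral_adj ag)).
split=> [tw g h [a [b [ag bh ab0]]]|sigmaV a b ca cb].
  have := tw a b (spectral_fin_core ag) (spectral_fin_core bh).
  rewrite !(adjM_homogeneous g h)// => /eqP.
  rewrite -subr_eq0 -scalerBl scaler_eq0 subr_eq0 => /orP[/eqP//|/eqP ab0'].
  by move: ab0; rewrite -[smul a b]adjK ab0' adj0 eqxx.
elim/fin_core_ind: a / ca => [g a ag|a a' ca ca' IH IH']; last first.
  by rewrite twistDl// !adjD twistDr ?IH ?IH'//; exact: fin_core_adj.
have ca := spectral_fin_core ag.
elim/fin_core_ind: b / cb => [h b bh|b b' cb cb' IH IH']; last first.
  by rewrite twistDr// !adjD twistDl ?IH ?IH'//; exact: fin_core_adj.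
rewrite !(adjM_homogeneous g h)//.
have [->|ab0] := eqVneq (smul a b) 0; first by rewrite adj0 !scaler0.
by rewrite sigmaV//; exists a, b.
Qed.

End Twist.

End Spectral.

(* All functions on K, with pointwise operations and K acting by translation:
   each character g has degree g, and a product of characters never vanishes.
   Hence compatibility of the involution for this action forces the identity on
   sigma in all degrees. *)
Section Translations.
Context {R : realType} {K : topologicalZmodType}.
Local Notation F := (K -> R[i]^o).

Definition translation_algebra : Type := F.
HB.instance Definition _ := GRing.Lmodule.on translation_algebra.
Implicit Types (u v w : translation_algebra).

Let mul u v : translation_algebra := fun t => u t * v t.
Let conj u : translation_algebra := fun t => (u t)^*.

Fact translation_mulA u v w : mul u (mul v w) = mul (mul u v) w.
Proof. by apply/funext => t; exact: mulrA. Qed.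

Fact translation_linearl (k : R[i]) u v w :
  mul (k *: u + v) w = k *: mul u w + mul v w.
Proof. by apply/funext => t; rewrite /mul !fctE mulrDl -scalerAl. Qed.

Fact translation_linearr (k : R[i]) u v w :
  mul u (k *: v + w) = k *: mul u v + mul u w.
Proof. by apply/funext => t; rewrite /mul !fctE mulrDr -scalerAr. Qed.

Fact translation_conjlinear (k : R[i]) u v :
  conj (k *: u + v) = k^* *: conj u + conj v.
Proof. by apply/funext => t; rewrite /conj !fctE rmorphD rmorphM. Qed.

Fact translation_conjM u v : conj (mul u v) = mul (conj v) (conj u).
Proof. by apply/funext => t; rewrite /conj /mul rmorphM mulrC. Qed.

Fact translation_conjK u : conj (conj u) = u.
Proof. by apply/funext => t; exact: conjCK. Qed.

HB.instance Definition _ := Lmodule_isStarAlgebra.Build R translation_algebra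
  translation_mulA translation_linearl translation_linearr
  translation_conjlinear translation_conjM translation_conjK.

Definition translation : star_action K translation_algebra.
Proof.
apply: (@StarAction R K translation_algebra (fun t u s => u (s + t))) => //.
- by move=> u; apply/funext => s; rewrite addr0.
- by move=> s t u; apply/funext => r; rewrite addrA addrAC.
Defined.

Lemma spectral_translation (g : dual R K) :
  spectral translation g (g : translation_algebra).
Proof. by move=> t; apply/funext => s; rewrite /= charD mulrC. Qed.

Lemma translation_charM_neq0 (g h : dual R K) :
  smul (g : translation_algebra) (h : translation_algebra) != 0.
Proof.
(* Evaluation at one point, here 0, suffices, as characters take nonzero values everywhere. *)
apply/eqP => /(congr1 (fun u : F => u 0)) /eqP.
by apply/negP; exact: mulf_neq0 (char_neq0 _ _) (char_neq0 _ _).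
Qed.

End Translations.

Theorem theorem11p2 (R : realType) (K : topologicalZmodType)
    (K_compact : compact [set: K]) (K_hausdorff : hausdorff_space K)
    (A : starAlgType R) (alpha : star_action K A) :
  star_grading (spectral alpha) (fin_core alpha) /\
  (forall sigma : dual R K -> dual R K -> R[i],
    normalized_unitary_cocycle sigma ->
    [/\ (* the twisted product is well defined on the core, *)
        twisted_product alpha sigma (twist alpha sigma) /\
        (forall m, twisted_product alpha sigma m ->
           forall a b, fin_core alpha a -> fin_core alpha b ->
             m a b = twist alpha sigma a b),
        (* it is associative, *)
        forall a b c, fin_core alpha a -> fin_core alpha b ->
          fin_core alpha c ->
          twist alpha sigma a (twist alpha sigma b c) =
          twist alpha sigma (twist alpha sigma a b) c,
        (* compatibility with the involution of A: a condition on the pairs of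
           degrees whose spectral subspaces have a nonzero product, *)
        twist_adjM alpha sigma <->
        (forall g h,
           (exists a b, [/\ spectral alpha g a, spectral alpha h b &
                            smul a b != 0]) ->
           (sigma g h)^* = sigma (- h) (- g)),
        (* hence on all pairs of degrees if no such product vanishes, *)
        (forall g h, exists a b, [/\ spectral alpha g a, spectral alpha h b &
                                     smul a b != 0]) ->
        (twist_adjM alpha sigma <->
         (forall g h, (sigma g h)^* = sigma (- h) (- g))) &
        (* and on all pairs of degrees for all actions of K together *)
        (forall (B : starAlgType R) (beta : star_action K B),
           twist_adjM beta sigma) <->
        (forall g h, (sigma g h)^* = sigma (- h) (- g))]) /\
  (forall (beta : star_action K A),
    (forall g, spectral beta g = spectral alpha g) ->
    fin_core beta = fin_core alpha /\
    forall sigma : dual R K -> dual R K -> R[i],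
      normalized_unitary_cocycle sigma ->
      forall a b, fin_core alpha a -> fin_core alpha b ->
        twist beta sigma a b = twist alpha sigma a b).
Proof.
split; first exact: spectral_grading.
split=> [sigma [_ _ _ sigmaA]|beta eq_spec]; last first.
  (* The core and the twisted product involve the action only through its family of spectral
     subspaces. *)
  have eq_sp : spectral beta = spectral alpha by apply/funext.
  by rewrite /fin_core /twist eq_sp.
split.
- by split; [exact: twist_twisted_product | exact: twisted_product_uniq].
- by move=> a b c; exact: twistA.
- exact: twist_adjMP.
- move=> nz; split=> [/twist_adjMP sigmaV g h|sigmaV]; first exact: sigmaV.
  by apply/twist_adjMP.
- split=> [tw g h|sigmaV B beta]; last by apply/twist_adjMP.
  (* The translation action tests every pair of degrees, with the characters [g] and [h] themselves
     as witnesses. *)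
  have /twist_adjMP := tw translation_algebra translation; apply.
  exists (g : translation_algebra), (h : translation_algebra).
  by split; [exact: spectral_translation.. | exact: translation_charM_neq0].
Qed.
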